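(* Let $G$ be a finite simple graph and let $v$ be a vertex of $G$. Then \[\mathrm{reg}(G)\leq\max\{\mathrm{reg}(G\setminus v),\ \mathrm{reg}(N_G(v))+1\}.\]
   Context: All graphs are finite and simple. $G\setminus v$ is the induced subgraph of $G$ on $V(G)\setminus\{v\}$, and the open neighborhood $N_G(v)$ is the induced subgraph of $G$ on the vertices adjacent to $v$. Fix a field $k$ of characteristic $0$. For a graph $G$ with vertex set $[n]$, the non-edge ideal is $I(G)=\langle x_ix_j : i\neq j,\ ij\notin E(G)\rangle\subseteq k[x_1,\dots,x_n]$, and $\mathrm{reg}(G):=\max\{r : \beta_{i,i+r}(I(G))\neq 0 \text{ for some } i\}$ is its Castelnuovo-Mumford regularity, where $\beta_{i,j}$ are the graded Betti numbers. If $G$ is complete (so $I(G)=0$), $\mathrm{reg}(G)=1$ by convention; the graph with no vertices is counted as complete. *)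

(* Defs.v *)
From HB Require Import structures.
From mathcomp Require Import all_boot all_order all_algebra.
From mathcomp Require Import mpoly.
From Stdlib Require Import ClassicalEpsilon.

Set Implicit Arguments.
Unset Strict Implicit.
Unset Printing Implicit Defensive.

Import GRing.Theory.
Local Open Scope ring_scope.

Record sgraph := SGraph {
  vertex :> finType;
  edge : rel vertex;
  edge_sym : ssrbool.symmetric edge;
  edge_irr : irreflexive edge }.

Section Induced.
Variables (G : sgraph) (A : {set G}).

Let sub_edge : rel {x : G | x \in A} := fun x y => edge (val x) (val y).

Fact induced_sym : ssrbool.symmetric sub_edge.
Proof. by move=> x y; exact: edge_sym. Qed.

Fact induced_irr : irreflexive sub_edge.
Proof. by move=> x; exact: edge_irr. Qed.

Definition induced : sgraph := SGraph induced_sym induced_irr.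
End Induced.

Definition del_vertex (G : sgraph) (v : G) : sgraph := induced [set~ v].

Definition open_nbhd (G : sgraph) (v : G) : sgraph :=
  induced [set w : G | edge v w].

Definition is_complete (G : sgraph) : bool :=
  [forall x : G, forall y : G, (x != y) ==> edge x y].

(* The polynomial ring of G is {mpoly k[#|G|]}; the variable of a vertex x is
   'X_(enum_rank x). *)
Definition nonedge_ideal (k : fieldType) (G : sgraph) (f : {mpoly k[#|G|]}) :
    Prop :=
  exists c : G * G -> {mpoly k[#|G|]},
    f = \sum_(e : G * G | (e.1 != e.2) && ~~ edge e.1 e.2)
          c e * ('X_(enum_rank e.1) * 'X_(enum_rank e.2)).

(* A sequence of finitely generated graded free modules over S = k[x_1..x_n]
     ... -> F_2 -> F_1 -> F_0 -> S
   where F_i has rank [rank i] and its a-th basis element has degree [gen i a].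
   Elements of F_i are row vectors and maps act by right multiplication.
   Degrees are in nat, which loses nothing for minimal resolutions of ideals
   of S. *)
Record free_seq (k : fieldType) (n : nat) := FreeSeq {
  rank : nat -> nat;
  gen : forall i, 'I_(rank i) -> nat;
  aug : 'cV[{mpoly k[n]}]_(rank 0);
  diff : forall i, 'M[{mpoly k[n]}]_(rank i.+1, rank i) }.

Section Resolution.
Variables (k : fieldType) (n : nat).
Implicit Types (I : {mpoly k[n]} -> Prop) (F : free_seq k n).

(* All maps have degree 0; a zero entry satisfies the condition vacuously. *)
Definition graded F : Prop :=
  (forall a m, m \in msupp (aug F a 0) -> mdeg m = gen a) /\
  (forall i a b m, m \in msupp (diff F i a b) ->
     (mdeg m + gen b)%N = gen a).

Definition resolves I F : Prop :=
  [/\ forall f, I f <-> exists u : 'rV_(rank F 0), f = (u *m aug F) 0 0,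
      forall u : 'rV_(rank F 0), u *m aug F = 0 <->
        exists w : 'rV_(rank F 1), u = w *m diff F 0
    & forall i (u : 'rV_(rank F i.+1)), u *m diff F i = 0 <->
        exists w : 'rV_(rank F i.+2), u = w *m diff F i.+1].

(* The image of F_(i+1) lies in <x_1,...,x_n> F_i: the entries of the matrices
   have no constant term. *)
Definition minimal F : Prop :=
  forall i a b, (diff F i a b)@_(0%MM) = 0.

Definition minimal_graded_free_resolution I F : Prop :=
  [/\ graded F, resolves I F & minimal F].

Definition is_betti I (beta : nat -> nat -> nat) : Prop :=
  exists2 F, minimal_graded_free_resolution I F &
    forall i j, beta i j = #|[set a : 'I_(rank F i) | gen a == j]|.

(* For a homogeneous ideal I, there is exactly one (extensionally) beta such
   that [is_betti I beta]. *)
Definition betti I : nat -> nat -> nat :=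
  epsilon (inhabits (fun _ _ => 0%N)) (is_betti I).
End Resolution.

(* The largest natural number satisfying P, if there is one. *)
Definition max_nat (P : nat -> Prop) : nat :=
  epsilon (inhabits 0%N) (fun m => P m /\ forall r, P r -> (r <= m)%N).

Definition reg (k : fieldType) (G : sgraph) : nat :=
  if is_complete G then 1%N else
  max_nat (fun r => exists i, betti (@nonedge_ideal k G) i (i + r) <> 0%N).

(* Main.v *)
(** Call an ideal I "r-bounded" if it has a graded free resolution, minimal or
    not, whose generators in homological degree i have degree at most i + r.
    Comparing such a resolution with a minimal one modulo the variables shows
    that reg(G) is the least r > 0 for which the nonedge ideal I(G) is
    r-bounded.
    Let A be the extension of I(G \ v) to the polynomial ring of G, and let
    M = I(G) : x_v.  Then I(G) = A + x_v M, and M is generated by I(N_G(v)) and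
    the variables of the non-neighbours of v.  As x_v is a nonzerodivisor
    modulo A, the sequence 0 -> A(-1) -> A (+) M(-1) -> I(G) -> 0 is exact, and
    a mapping cone shows that I(G) is r-bounded as soon as A is r-bounded and
    M is (r-1)-bounded.  The same cone with M the unit ideal adjoins a fresh
    variable to an ideal, so M is (r-1)-bounded if I(N_G(v)) is; and extending
    scalars to a larger polynomial ring is flat. *)

From HB Require Import structures.
Require Import Defs.
From mathcomp Require Import all_boot all_order all_algebra.
From mathcomp Require Import mpoly.
From Stdlib Require Import ClassicalEpsilon.

Set Implicit Arguments.
Unset Strict Implicit.
Unset Printing Implicit Defensive.

Import GRing.Theory.
Local Open Scope ring_scope.

(** * Graded maps *)

Section MonomialLinear.
Variables (k : fieldType) (n m : nat).
Implicit Types (T : 'X_{1..n} -> {mpoly k[m]}) (p : {mpoly k[n]}).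

(** The [k]-linear extension of a map given on monomials. Projections to homogeneous components and
    coordinates over a smaller polynomial ring are both of this form. *)
Definition mlin T p : {mpoly k[m]} := \sum_(t <- msupp p) p@_t *: T t.

(** Monomials outside the support contribute zero, so several polynomials can share one list of
    monomials; linearity follows. *)
Lemma mlin_widen T p (s : seq 'X_{1..n}) :
  uniq s -> {subset msupp p <= s} -> mlin T p = \sum_(t <- s) p@_t *: T t.
Proof.
move=> us sub; rewrite (bigID (fun t => t \in msupp p)) /= addrC big1 ?add0r.
  rewrite -big_filter; apply: perm_big; apply: uniq_perm.
  - exact: msupp_uniq.
  - by rewrite filter_uniq.
  by move=> t; rewrite mem_filter; case: (boolP (t \in msupp p)) => // /sub ->.
by move=> t; rewrite -mcoeff_eq0 => /eqP ->; rewrite scale0r.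
Qed.

Fact mlin_is_linear T : linear (mlin T).
Proof.
move=> c p q; set s := undup (msupp (c *: p + q) ++ msupp p ++ msupp q).
have us : uniq s by rewrite undup_uniq.
rewrite !(@mlin_widen _ _ s) //; last 3 first.
1-3: by move=> t tp; rewrite mem_undup !mem_cat tp ?orbT.
rewrite scaler_sumr -big_split /=; apply: eq_bigr => t _.
by rewrite mcoeffD mcoeffZ scalerDl scalerA.
Qed.

HB.instance Definition _ T :=
  GRing.isLinear.Build k {mpoly k[n]} {mpoly k[m]} _ (mlin T) (mlin_is_linear T).

Lemma mlinX T t : mlin T 'X_[t] = T t.
Proof. by rewrite /mlin msuppX big_seq1 mcoeffX eqxx scale1r. Qed.

(** By linearity, monomials suffice. Two maps [T] and [T'] are allowed because multiplication by a
    homogeneous [q] shifts the degree that a projection selects. *)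
Lemma mlinMr T T' (q : {mpoly k[n]}) (q' : {mpoly k[m]}) :
  (forall t, mlin T ('X_[t] * q) = T' t * q') ->
  forall p, mlin T (p * q) = mlin T' p * q'.
Proof.
move=> h p; rewrite {1}[p]mpolyE mulr_suml linear_sum /= {2}/mlin mulr_suml.
by apply: eq_bigr => t _; rewrite -scalerAl linearZ /= h -scalerAl.
Qed.

Lemma mcoeff_mlin_monomial p (P : pred 'X_{1..n}) (f : _ -> 'X_{1..m}) t :
    {in P &, injective f} -> P t ->
  (mlin (fun a => if P a then 'X_[f a] else 0) p)@_(f t) = p@_t.
Proof.
move=> inj Pt; set s := undup (t :: msupp p).
have us : uniq s by rewrite undup_uniq.
rewrite (mlin_widen _ us); last by move=> a ap; rewrite mem_undup inE ap orbT.
rewrite raddf_sum (bigD1_seq t) //= ?mem_undup ?mem_head //.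
rewrite Pt mcoeffZ mcoeffX eqxx mulr1 big1 ?addr0 // => a nat_.
case: ifP => Pa; rewrite mcoeffZ ?mcoeff0 ?mulr0 // mcoeffX.
case: eqP => [eq_fat|_]; last by rewrite mulr0.
by rewrite (inj a t Pa Pt eq_fat) eqxx in nat_.
Qed.

End MonomialLinear.

Section HomogeneousComponents.
Variables (k : fieldType) (n : nat).
Local Notation S := {mpoly k[n]}.

(* Row vectors are elements of the graded free module whose b-th basis vector
   has degree [g b]. *)
Definition hcomp r (g : 'I_r -> nat) (d : nat) (u : 'rV[S]_r) : 'rV[S]_r :=
  \row_b mlin (fun t => if (mdeg t + g b == d)%N then 'X_[t] else 0) (u 0 b).

Definition graded_mx p q (g1 : 'I_p -> nat) (g0 : 'I_q -> nat)
    (D : 'M[S]_(p, q)) : Prop :=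
  forall a b t, t \in msupp (D a b) -> (mdeg t + g0 b)%N = g1 a.

Lemma mcoeff_hcomp r (g : 'I_r -> nat) d u b t :
  (hcomp g d u 0 b)@_t = if (mdeg t + g b == d)%N then (u 0 b)@_t else 0.
Proof.
rewrite mxE; case: ifP => dt.
  exact: (@mcoeff_mlin_monomial _ _ _ _
    (fun a : 'X_{1..n} => mdeg a + g b == d)%N id).
rewrite /mlin raddf_sum big1 //= => a _; rewrite mcoeffZ.
case: ifP => da; rewrite ?mcoeff0 ?mulr0 // mcoeffX.
by case: (a =P t) da dt => [-> ->|]; rewrite ?mulr0.
Qed.

Lemma hcomp_is_graded r (g : 'I_r -> nat) d u b t :
  t \in msupp (hcomp g d u 0 b) -> (mdeg t + g b)%N = d.
Proof.
by rewrite mcoeff_msupp mcoeff_hcomp; case: (eqVneq _ d) => //; rewrite eqxx.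
Qed.

Lemma hcomp_id r (g : 'I_r -> nat) d (u : 'rV[S]_r) :
  (forall b t, t \in msupp (u 0 b) -> (mdeg t + g b)%N = d) -> hcomp g d u = u.
Proof.
move=> hu; apply/rowP => b; apply/mpolyP => t; rewrite mcoeff_hcomp.
case: eqP => // nd; apply/esym/eqP; rewrite mcoeff_eq0.
by apply/negP => /hu.
Qed.

(** The entry of [D] at [b], [c] is homogeneous of degree [g1 b - g0 c], so multiplication by it
    carries the selected monomials exactly to the selected ones. *)
Lemma hcompM p q (g1 : 'I_p -> nat) (g0 : 'I_q -> nat) (D : 'M[S]_(p, q)) d u :
  graded_mx g1 g0 D -> hcomp g0 d (u *m D) = hcomp g1 d u *m D.
Proof.
move=> gD; apply/rowP => c; rewrite !mxE linear_sum /=.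
apply: eq_bigr => b _; rewrite mxE; apply: mlinMr => a.
rewrite [D b c in LHS]mpolyE mulr_sumr linear_sum /= [D b c in RHS]mpolyE.
rewrite mulr_sumr; apply: eq_big_seq => t tD.
rewrite -!scalerAr linearZ /= -mpolyXD mlinX mdegD -addnA (gD _ _ _ tD).
by case: eqP => _; rewrite ?mpolyXD ?mul0r.
Qed.

Lemma hcomp_sum r (g : 'I_r -> nat) (u : 'rV[S]_r) :
  exists N, u = \sum_(d < N) hcomp g d u.
Proof.
(* [msize] exceeds the degree of every monomial of an entry, so no term of [u] has degree [N] or
   more. *)
pose N := (\max_(b < r) (msize (u 0%R b) + g b)).+1; exists N.
apply/rowP => b; apply/mpolyP => t; rewrite summxE raddf_sum /=.
under eq_bigr do rewrite mcoeff_hcomp.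
rewrite -big_mkcond /=; have [ut|] := boolP (t \in msupp (u 0 b)).
  have lt : (mdeg t + g b < N)%N.
    rewrite ltnS (leq_trans _ (leq_bigmax b)) // leq_add2r ltnW //.
    exact: msize_mdeg_lt.
  by rewrite (big_pred1 (Ordinal lt)).
by rewrite -mcoeff_eq0 => /eqP->; rewrite big1.
Qed.

(** Membership in the submodule generated by the rows of [D], that is, in the image of [D]. *)
Definition factors p q (D : 'M[S]_(p, q)) (u : 'rV[S]_q) : Prop :=
  exists w, u = w *m D.

Definition exact p q r (D' : 'M[S]_(r, p)) (D : 'M[S]_(p, q)) : Prop :=
  forall u : 'rV_p, u *m D = 0 <-> factors D' u.

Lemma exact_comp p q r (D' : 'M[S]_(r, p)) (D : 'M[S]_(p, q)) :
  exact D' D -> D' *m D = 0.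
Proof.
move=> ex; apply/row_matrixP => a; rewrite row_mul row0; apply/ex.
by exists (delta_mx 0 a); rewrite -rowE.
Qed.

Lemma factors_mx p q r (D : 'M[S]_(p, q)) (U : 'M[S]_(r, q)) :
  (forall a, factors D (row a U)) -> exists W, U = W *m D.
Proof.
case/fin_all_exists => w hw.
exists (\matrix_a w a); apply/row_matrixP => a.
by rewrite hw row_mul rowK.
Qed.

(** Projectivity of free modules: each row of [U] is a syzygy of [D] and lifts separately. *)
Lemma exact_lift p q r s (D' : 'M[S]_(r, p)) (D : 'M[S]_(p, q))
    (U : 'M[S]_(s, p)) : exact D' D -> U *m D = 0 -> exists W, U = W *m D'.
Proof.
move=> ex UD; apply: factors_mx => a; apply/ex.
by rewrite -row_mul UD row0.
Qed.

(** Replacing each row of a solution by its component in the degree of that row makes it graded, and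
    by [hcompM] it remains a solution. *)
Lemma graded_lift p q r (gU : 'I_r -> nat) (g1 : 'I_p -> nat)
    (g0 : 'I_q -> nat) (D : 'M[S]_(p, q)) (U : 'M[S]_(r, q)) :
  graded_mx g1 g0 D -> graded_mx gU g0 U -> (exists W, U = W *m D) ->
  exists2 W, graded_mx gU g1 W & U = W *m D.
Proof.
move=> gD hU [W UW]; exists (\matrix_a hcomp g1 (gU a) (row a W)).
  move=> a b t; have -> (A : 'M[S]_(r, p)) : A a b = row a A 0 b by rewrite mxE.
  by rewrite rowK; apply: hcomp_is_graded.
apply/row_matrixP => a; rewrite row_mul rowK -(hcompM _ _ gD) -row_mul -UW.
by apply/esym/hcomp_id => b t; rewrite mxE; apply: hU.
Qed.

Lemma graded_mxM p q r (g2 : 'I_r -> nat) (g1 : 'I_p -> nat)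
    (g0 : 'I_q -> nat) (U : 'M[S]_(r, p)) (D : 'M[S]_(p, q)) :
  graded_mx g2 g1 U -> graded_mx g1 g0 D -> graded_mx g2 g0 (U *m D).
Proof.
move=> gU gD a c t; rewrite mcoeff_msupp mxE raddf_sum /= => nz.
have [b] : exists b, (U a b * D b c)@_t != 0.
  apply/existsP; apply: contraNT nz => /existsPn h; rewrite big1 // => b _.
  by have := h b; rewrite negbK => /eqP.
rewrite -mcoeff_msupp => /msuppM_le /allpairsP [[t1 t2] /= [h1 h2 ->]].
by rewrite mdegD -addnA (gD _ _ _ h2) (gU _ _ _ h1).
Qed.

End HomogeneousComponents.

(** * Comparison of resolutions *)

Section Factors.
Variables (k : fieldType) (n : nat).
Local Notation S := {mpoly k[n]}.

Lemma factors_row p q (D : 'M[S]_(p, q)) a : factors D (row a D).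
Proof. by exists (delta_mx 0 a); rewrite -rowE. Qed.

Lemma factors_scale p q (D : 'M[S]_(p, q)) c u :
  factors D u -> factors D (c *: u).
Proof. by case=> w ->; exists (c *: w); rewrite scalemxAl. Qed.

Lemma factors_sum p q (D : 'M[S]_(p, q)) (I : Type) (s : seq I) (P : pred I) u :
  (forall i, P i -> factors D (u i)) -> factors D (\sum_(i <- s | P i) u i).
Proof.
move=> h; apply: big_ind => //; first by exists 0; rewrite mul0mx.
by move=> _ _ [v ->] [w ->]; exists (v + w); rewrite mulmxDl.
Qed.

Lemma factors_trans p q r (D : 'M[S]_(p, q)) (X : 'M[S]_(r, q)) u :
  (forall a, factors D (row a X)) -> factors X u -> factors D u.
Proof.
by case/factors_mx => W -> [w ->]; exists (w *m W); rewrite mulmxA.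
Qed.

Lemma row_row' p q (X : 'M[S]_(p, q)) (a : 'I_p) b :
  row b (row' a X) = row (lift a b) X.
Proof. by apply/rowP => c; rewrite !mxE. Qed.

Definition constant_free p q (M : 'M[S]_(p, q)) : Prop :=
  forall a b, (M a b)@_0%MM = 0.

Lemma constant_free_mulr p q r (A : 'M[S]_(p, q)) (B : 'M[S]_(q, r)) :
  constant_free A -> constant_free (A *m B).
Proof.
move=> cA a b; rewrite mxE raddf_sum big1 // => c _.
by rewrite [LHS]rmorphM /= cA mul0r.
Qed.

Lemma constant_free_mull p q r (A : 'M[S]_(p, q)) (B : 'M[S]_(q, r)) :
  constant_free B -> constant_free (A *m B).
Proof.
move=> cB a b; rewrite mxE raddf_sum big1 // => c _.
by rewrite [LHS]rmorphM /= cB mulr0.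
Qed.

(** For homogeneous rows this is minimality of the generators: a syzygy with a nonzero constant term
    would express one row through the others. *)
Definition irredundant p q (X : 'M[S]_(p, q)) : Prop :=
  forall u : 'rV_p, u *m X = 0 -> constant_free u.

Lemma irredundant_exact p q r (D : 'M[S]_(p, q)) (D' : 'M[S]_(r, p)) :
  irredundant D -> exact D' D -> constant_free D'.
Proof.
move=> irr ex a b.
have : row a D' *m D = 0 by rewrite -row_mul exact_comp // row0.
by move/irr/(_ 0 b); rewrite mxE.
Qed.

(** The hypothesis says that the submodule is graded, so the components of its generators belong to
    it and generate it. *)
Lemma homogeneous_generators r q (X : 'M[S]_(r, q)) (g : 'I_q -> nat) :
    (forall u d, factors X u -> factors X (hcomp g d u)) ->
  exists r' (g' : 'I_r' -> nat) (X' : 'M[S]_(r', q)),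
    graded_mx g' g X' /\ forall u, factors X u <-> factors X' u.
Proof.
move=> hX.
have /fin_all_exists[N hN] a := hcomp_sum g (row a X).
pose I : finType := {a : 'I_r & 'I_(N a)}.
pose x (i : I) := hcomp g (tagged i) (row (tag i) X).
exists #|{: I}|, (fun c : 'I_#|I| => tagged (enum_val c) : nat), (\matrix_c x (enum_val c)).
split=> [c b t|u].
  have -> (A : 'M[S]_(#|I|, q)) : A c b = row c A 0 b by rewrite mxE.
  by rewrite rowK; apply: hcomp_is_graded.
split; apply: factors_trans => a; last first.
  by rewrite rowK; apply/hX/factors_row.
rewrite hN; apply: factors_sum => d _.
set X' := \matrix_c _; suff <- : row (enum_rank (Tagged (fun a => 'I_(N a)) d : I)) X' =
  hcomp g d (row a X) by exact: factors_row.
by rewrite rowK enum_rankK.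
Qed.

(** The component of the syzygy [u] in degree [g' a] is again a syzygy, and its entry at [a] is a
    nonzero scalar; dividing by it solves for row [a]. *)
Lemma drop_redundant r q (g' : 'I_r.+1 -> nat) (g : 'I_q -> nat)
    (X : 'M[S]_(r.+1, q)) (u : 'rV_r.+1) a :
    graded_mx g' g X -> u *m X = 0 -> (u 0 a)@_0%MM != 0 ->
  factors (row' a X) (row a X).
Proof.
move=> gX uX nz; set v := hcomp g' (g' a) u.
have vX : v *m X = 0.
  rewrite -(hcompM _ _ gX) uX; apply/rowP => b; apply/mpolyP => t.
  by rewrite mcoeff_hcomp mxE mcoeff0 if_same.
have va : v 0 a = ((u 0 a)@_0%MM)%:MP.
  apply/mpolyP => t; rewrite mcoeff_hcomp mcoeffC -{2}[g' a]add0n eqn_add2r.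
  rewrite mdeg_eq0; by case: eqP => [->|_]; rewrite ?mulr1 ?mulr0.
have -> : row a X =
    (- ((u 0 a)@_0%MM)^-1)%:MP *: \sum_(b | b != a) v 0 b *: row b X.
  have := mulmx_sum_row v X; rewrite vX (bigD1 a) //= va => /esym/eqP.
  rewrite addr_eq0 => /eqP /(congr1 (fun w => (((u 0 a)@_0%MM)^-1)%:MP *: w)).
  by rewrite scalerA -mpolyCM mulVf // mpolyC1 scale1r mpolyCN scaleNr scalerN.
apply/factors_scale/factors_sum => b; rewrite eq_sym => nba; apply: factors_scale.
have [j -> _] := unlift_some nba.
by rewrite -row_row'; apply: factors_row.
Qed.

Lemma irredundant_generators r q (X : 'M[S]_(r, q)) (g : 'I_q -> nat) :
    (forall u d, factors X u -> factors X (hcomp g d u)) ->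
  exists r' (g' : 'I_r' -> nat) (X' : 'M[S]_(r', q)),
    [/\ graded_mx g' g X', forall u, factors X u <-> factors X' u
      & irredundant X'].
Proof.
case/homogeneous_generators=> p [g1] [X1] []; elim: p => [|p IH] in g1 X1 *.
  by exists 0%N, g1, X1; split=> // u _ i [].
move=> gX1 hX1; have [irr|red] := classic (irredundant X1).
  by exists p.+1, g1, X1.
have [u [uX [a nz]]] : exists u : 'rV_p.+1,
    u *m X1 = 0 /\ exists a, (u 0 a)@_0%MM != 0.
  apply: NNPP => h; apply: red => u uX i a; rewrite ord1; apply/eqP.
  by apply: contraT => nz; case: h; exists u; split=> //; exists a.
apply: (IH (fun b => g1 (lift a b)) (row' a X1)).
  by move=> b c t; rewrite mxE; apply: gX1.
move=> w; rewrite hX1; split; apply: factors_trans => b.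
  have [<-|nba] := eqVneq a b; first exact: (drop_redundant gX1 uX).
  have [j -> _] := unlift_some nba.
  by rewrite -row_row'; apply: factors_row.
by have -> := row_row' X1 a b; apply: factors_row.
Qed.

End Factors.

Section Comparison.
Variables (k : fieldType) (n : nat).
Local Notation S := {mpoly k[n]}.

(* One level of two chain maps phi, psi between resolutions and of a homotopy
   from psi o phi to the identity.  The last component of the homotopy is not
   constructed yet; the fourth clause is what makes its existence follow from
   exactness. *)
Definition comparable a1 a0 b1 b0 (gF : 'I_a1 -> nat) (gP : 'I_b1 -> nat)
    (D : 'M[S]_(a1, a0)) (E : 'M[S]_(b1, b0)) : Prop :=
  exists phi0 phi psi0 psi h,
    [/\ graded_mx gF gP phi, D *m phi0 = phi *m E, E *m psi0 = psi *m D,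
        (1%:M - phi *m psi - D *m h) *m D = 0 & constant_free (D *m h)].

(** Both maps end in the ring itself, so identities serve there and the homotopy starts at zero. *)
Lemma comparable_aug a b (gF : 'I_a -> nat) (gP : 'I_b -> nat)
    (D : 'M[S]_(a, 1)) (E : 'M[S]_(b, 1)) :
    graded_mx gF (fun=> 0%N) D -> graded_mx gP (fun=> 0%N) E ->
    (forall u, factors D u <-> factors E u) ->
  comparable gF gP D E.
Proof.
move=> gD gE DE.
have [|phi gphi phiE] := graded_lift gE gD.
  by apply: factors_mx => i; apply/DE/factors_row.
have [|psi psiD] := @factors_mx _ _ _ _ _ D E.
  by move=> i; apply/DE/factors_row.
exists 1%:M, phi, 1%:M, psi, 0; rewrite !mulmx1 mulmx0 subr0; split=> //.
  by rewrite mulmxBl mul1mx -mulmxA -psiD phiE subrr.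
by move=> i j; rewrite mxE mcoeff0.
Qed.

(** The fourth clause and exactness yield the next homotopy component [h']; [D' *m h'] has no
    constant terms because [D'] has none. *)
Lemma comparable_step a2 a1 a0 b2 b1 b0 (gF' : 'I_a2 -> nat)
    (gF : 'I_a1 -> nat) (gP' : 'I_b2 -> nat) (gP : 'I_b1 -> nat)
    (D' : 'M[S]_(a2, a1)) (D : 'M[S]_(a1, a0))
    (E' : 'M[S]_(b2, b1)) (E : 'M[S]_(b1, b0)) :
    comparable gF gP D E -> exact D' D -> exact E' E ->
    graded_mx gF' gF D' -> graded_mx gP' gP E' -> constant_free D' ->
  comparable gF' gP' D' E'.
Proof.
move=> [phi0] [phi] [psi0] [psi] [h] [gphi Dphi Epsi hD _] exD exE gD gE cD.
have [D'D E'E] := (exact_comp exD, exact_comp exE).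
have [|phi' gphi' phiE'] := graded_lift gE (graded_mxM gD gphi).
  by apply: exact_lift exE _; rewrite -mulmxA -Dphi mulmxA D'D mul0mx.
have [|psi' psiD'] := exact_lift (U := E' *m psi) exD.
  by rewrite -mulmxA -Epsi mulmxA E'E mul0mx.
have [h' hD'] := exact_lift exD hD.
exists phi, phi', psi, psi', h'; split=> //; last exact: constant_free_mulr.
rewrite !mulmxBl mul1mx -!mulmxA -psiD' -hD' [phi' *m _]mulmxA -phiE'.
by rewrite !mulmxBr mulmx1 [D' *m (D *m h)]mulmxA D'D mul0mx subr0 mulmxA subrr.
Qed.

(* The homotopy identity [1 = phi psi + D h + h' D'] becomes [1 = phi psi]
   modulo the variables. *)
Lemma comparable_gen a2 a1 a0 b1 b0 (gF : 'I_a1 -> nat) (gP : 'I_b1 -> nat)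
    (D' : 'M[S]_(a2, a1)) (D : 'M[S]_(a1, a0)) (E : 'M[S]_(b1, b0)) :
    comparable gF gP D E -> exact D' D -> constant_free D' ->
  forall a, exists b, gF a = gP b.
Proof.
move=> [phi0] [phi] [psi0] [psi] [h] [gphi _ _ hD cDh] exD cD a.
have [h' hD'] := exact_lift exD hD.
have one : 1 = ((phi *m psi) a a)@_0%MM.
  have := congr1 (fun A : 'M_a1 => (A a a)@_0%MM) hD'.
  rewrite /= constant_free_mull // mxE [(- _ : 'M_ _) _ _]mxE mcoeffB cDh subr0.
  rewrite mxE [(- _ : 'M_ _) _ _]mxE mcoeffB mxE eqxx mcoeff1 eqxx.
  by move/eqP; rewrite subr_eq0 => /eqP.
have [b nz] : exists b, (phi a b)@_0%MM != 0.
  apply/existsP; apply: contraT => /existsPn phi_0; have := oner_neq0 k.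
  rewrite [1]one mxE raddf_sum big1 ?eqxx //= => b _.
  by rewrite [LHS]rmorphM /=; have := phi_0 b; rewrite negbK => /eqP->; rewrite mul0r.
by exists b; rewrite -(gphi a b 0%MM) ?mdeg0 // mcoeff_msupp.
Qed.

(** Finite generation of syzygies is transferred from the known resolution, without an appeal to
    Noetherianity: a syzygy [u] of [D] is [u] times the homotopy defect plus [u *m phi *m psi], and
    [u *m phi] is a syzygy of [E]. *)
Lemma comparable_syzygies a1 a0 b2 b1 b0 (gF : 'I_a1 -> nat)
    (gP : 'I_b1 -> nat) (D : 'M[S]_(a1, a0)) (E' : 'M[S]_(b2, b1))
    (E : 'M[S]_(b1, b0)) :
  comparable gF gP D E -> exact E' E -> exists r (X : 'M[S]_(r, a1)), exact X D.
Proof.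
move=> [phi0] [phi] [psi0] [psi] [h] [_ Dphi Epsi hD _] exE.
exists (a1 + b2)%N, (col_mx (1%:M - phi *m psi - D *m h) (E' *m psi)) => u.
split=> [uD|[w ->]]; last first.
  have E'psiD : E' *m psi *m D = 0.
    by rewrite -mulmxA -Epsi mulmxA (exact_comp exE) mul0mx.
  by rewrite -mulmxA mul_col_mx hD E'psiD col_mx0 mulmx0.
have /exE[w uphi] : (u *m phi) *m E = 0 by rewrite -mulmxA -Dphi mulmxA uD mul0mx.
exists (row_mx u w); rewrite mul_row_col mulmxA -uphi !mulmxBr mulmx1 !mulmxA.
by rewrite uD mul0mx subr0 subrK.
Qed.

End Comparison.

(** * Minimal resolutions *)

Section MinimalResolutions.
Variables (k : fieldType) (n : nat).
Local Notation S := {mpoly k[n]}.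
Implicit Types (F P : free_seq k n) (I : S -> Prop).

(* The augmented sequence, reindexed so that S sits in position 0. *)
Definition arank F i := if i is j.+1 then rank F j else 1%N.

Definition agen F i : 'I_(arank F i) -> nat :=
  if i is j.+1 then @gen k n F j else fun=> 0%N.

Definition adiff F i : 'M[S]_(arank F i.+1, arank F i) :=
  if i is j.+1 then diff F j else aug F.

Lemma graded_adiff F i : graded F -> graded_mx (@agen F i.+1) (@agen F i) (adiff F i).
Proof.
case: i => [|i] [gaug gdiff] a b t /=; last exact: gdiff.
by rewrite ord1 addn0; apply: gaug.
Qed.

Lemma exact_adiff I F i : resolves I F -> exact (adiff F i.+1) (adiff F i).
Proof. by case: i => [|i] [_ ex0 exS]; [apply: ex0 | apply: exS]. Qed.

Lemma factors_aug I F u : resolves I F -> factors (aug F) u <-> I (u 0 0).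
Proof.
case=> hI _ _; rewrite hI; split=> -[w hw]; exists w; first by rewrite hw.
by apply/rowP => i; rewrite ord1.
Qed.

Lemma comparable_resolutions I F P i :
    minimal_graded_free_resolution I F -> graded P -> resolves I P ->
  comparable (@agen F i.+1) (@agen P i.+1) (adiff F i) (adiff P i).
Proof.
move=> [gF rF mF] gP rP; elim: i => [|i IH].
  apply: comparable_aug; [exact: graded_adiff gF|exact: graded_adiff gP|].
  by move=> u; rewrite (factors_aug _ rF) (factors_aug _ rP).
apply: comparable_step IH _ _ _ _ _.
- exact: exact_adiff rF.
- exact: exact_adiff rP.
- exact: graded_adiff gF.
- exact: graded_adiff gP.
exact: mF.
Qed.

Lemma minimal_gen I F P i (a : 'I_(rank F i)) :
    minimal_graded_free_resolution I F -> graded P -> resolves I P ->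
  exists b : 'I_(rank P i), gen a = gen b.
Proof.
move=> mF gP rP; have cmp := comparable_resolutions i mF gP rP.
case: mF => gF rF mF.
exact: (comparable_gen cmp (exact_adiff (i := i) rF) (mF i) a).
Qed.

(** A map bundled with its sizes, so that a resolution of unknown ranks can be built by iterating a
    function on stages. *)
Record stage := Stage {
  stage_rank0 : nat;
  stage_rank : nat;
  stage_gen : 'I_stage_rank -> nat;
  stage_mx : 'M[S]_(stage_rank, stage_rank0) }.

Record extension (s : stage) := Extension {
  ext_rank : nat;
  ext_gen : 'I_ext_rank -> nat;
  ext_mx : 'M[S]_(ext_rank, stage_rank s) }.

Definition extend (s : stage) (x : extension s) : stage :=
  Stage (@ext_gen s x) (ext_mx x).

Definition good_extension (s : stage) (x : extension s) : Prop :=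
  [/\ graded_mx (@ext_gen s x) (@stage_gen s) (ext_mx x),
      exact (ext_mx x) (stage_mx s) & irredundant (ext_mx x)].

(** The invariant of the construction: comparability makes the next syzygies finitely generated,
    gradedness makes them a graded submodule, and irredundance makes the next map minimal. *)
Definition good_stage P i (s : stage) : Prop :=
  [/\ comparable (@stage_gen s) (@agen P i.+1) (stage_mx s) (adiff P i),
      irredundant (stage_mx s) &
      exists g0, graded_mx (@stage_gen s) g0 (stage_mx s)].

Lemma good_extension_ex I P i s : graded P -> resolves I P -> good_stage P i s ->
  exists x : extension s, good_extension x.
Proof.
move=> gP rP [cmp irr [g0 gs]].
have [r [X exX]] := comparable_syzygies cmp (exact_adiff (i := i) rP).
have [|r' [g' [X' [gX' XX' irrX']]]] :=
    @irredundant_generators k n _ _ X (@stage_gen s).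
  move=> u d /exX us; apply/exX; rewrite -(hcompM _ _ gs) us.
  apply/rowP => b; apply/mpolyP => t.
  by rewrite mcoeff_hcomp mxE mcoeff0 if_same.
by exists (Extension g' X'); split=> // u; rewrite exX XX'.
Qed.

Lemma good_extend I P i s (x : extension s) :
    graded P -> resolves I P -> good_stage P i s -> good_extension x ->
  good_stage P i.+1 (extend x).
Proof.
move=> gP rP [cmp irr _] [gx exx irrx]; split; last by exists (@stage_gen s).
  apply: (comparable_step cmp exx _ gx).
  - exact: exact_adiff rP.
  - exact: graded_adiff gP.
  exact: irredundant_exact irr exx.
exact: irrx.
Qed.

(** The empty matrix only makes the choice total; at a good stage a good extension exists. *)
Definition next_stage (s : stage) : stage :=
  extend (epsilon (inhabits (Extension (fun=> 0%N) (0 : 'M_(0, _))))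
                  (@good_extension s)).

Lemma minimal_resolution_exists I P : graded P -> resolves I P ->
  exists F, minimal_graded_free_resolution I F.
Proof.
move=> gP rP.
have gaugP := graded_adiff (i := 0) gP.
have [|r [g [X [gX PX irrX]]]] :=
    @irredundant_generators k n _ _ (aug P) (fun=> 0%N).
  by move=> u d [w ->]; exists (hcomp (@gen k n P 0) d w); rewrite (hcompM _ _ gaugP).
pose st i := iter i next_stage (Stage g X).
(* Stage 0 is the augmentation. By [extend], the row length of each stage is convertible to the rank
   of the preceding one, so the matrices fit without casts. *)
pose F := @FreeSeq k n (fun i => stage_rank (st i)) (fun i => @stage_gen (st i))
  X (fun i => stage_mx (st i.+1)).
have good i : good_stage P i (st i).
  elim: i => [|i IH]; last first.
    exact: (good_extend gP rP IH (epsilon_spec _ _ (good_extension_ex gP rP IH))).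
  split=> //=; last by exists (fun=> 0%N).
  apply: comparable_aug => //.
  by move=> u; rewrite PX.
have ext i : good_extension
    (epsilon (inhabits (Extension (fun=> 0%N) (0 : 'M_(0, _))))
             (@good_extension (st i))).
  exact: (epsilon_spec _ _ (good_extension_ex gP rP (good i))).
have irr i : irredundant (stage_mx (st i)) by case: (good i).
have ex i : exact (stage_mx (st i.+1)) (stage_mx (st i)) by case: (ext i).
exists F; split.
- split=> [a t|i a b t]; first by move/gX; rewrite addn0.
  by case: (ext i) => h _ _; apply: h.
- split=> [f||i]; last exact: (ex i.+1).
    rewrite -(_ : (f%:M : 'M_1) 0 0 = f); last by rewrite mxE mulr1n.
    rewrite -(factors_aug _ rP) PX; split=> -[w hw]; exists w; first by rewrite hw.
    by apply/rowP => i; rewrite ord1 hw.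
  exact: (ex 0%N).
by move=> i; apply: irredundant_exact (irr i) (ex i).
Qed.

End MinimalResolutions.

(** * Mapping cones *)

Section GradedBlocks.
Variables (k : fieldType) (n : nat).
Local Notation S := {mpoly k[n]}.

Definition gcat p q (g1 : 'I_p -> nat) (g2 : 'I_q -> nat) (a : 'I_(p + q)) :=
  match split a with inl b => g1 b | inr c => g2 c end.

Lemma graded_mx0 p q (g1 : 'I_p -> nat) (g0 : 'I_q -> nat) :
  graded_mx g1 g0 (0 : 'M[S]_(p, q)).
Proof. by move=> a b t; rewrite mxE msupp0. Qed.

Lemma graded_mxN p q (g1 : 'I_p -> nat) (g0 : 'I_q -> nat) (A : 'M[S]_(p, q)) :
  graded_mx g1 g0 A -> graded_mx g1 g0 (- A).
Proof. by move=> gA a b t; rewrite mxE (perm_mem (msuppN _)); apply: gA. Qed.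

Lemma graded_col_mx p1 p2 q (g1 : 'I_p1 -> nat) (g2 : 'I_p2 -> nat)
    (g0 : 'I_q -> nat) (A : 'M[S]_(p1, q)) (B : 'M[S]_(p2, q)) :
  graded_mx g1 g0 A -> graded_mx g2 g0 B -> graded_mx (gcat g1 g2) g0 (col_mx A B).
Proof.
by move=> gA gB a b t; rewrite mxE /gcat; case: split => c; [apply: gA|apply: gB].
Qed.

Lemma graded_row_mx p q1 q2 (g : 'I_p -> nat) (g1 : 'I_q1 -> nat)
    (g2 : 'I_q2 -> nat) (A : 'M[S]_(p, q1)) (B : 'M[S]_(p, q2)) :
  graded_mx g g1 A -> graded_mx g g2 B -> graded_mx g (gcat g1 g2) (row_mx A B).
Proof.
by move=> gA gB a b t; rewrite mxE /gcat; case: split => c; [apply: gA|apply: gB].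
Qed.

Lemma graded_mxX p q (g1 : 'I_p -> nat) (g0 : 'I_q -> nat) v (A : 'M[S]_(p, q)) :
  graded_mx g1 g0 A -> graded_mx (fun a => (g1 a).+1) g0 ('X_v *: A).
Proof.
move=> gA a b t; rewrite mxE => /msuppM_le /allpairsP [[t1 t2] /= [h1 h2 ->]].
by move/mem_msuppXP: h1 => <-; rewrite mdegD mdeg1 -addnA (gA _ _ _ h2).
Qed.

Lemma graded_mx1 p (g : 'I_p -> nat) : graded_mx g g (1%:M : 'M[S]_p).
Proof.
move=> a b t; rewrite mxE; case: eqP => [->|_]; last by rewrite msupp0.
by rewrite msupp1 inE => /eqP ->; rewrite mdeg0.
Qed.

End GradedBlocks.

(** * Ideals with degree-bounded resolutions, and chain maps between resolutions *)

Section Bounded.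
Variables (k : fieldType) (n : nat).
Local Notation S := {mpoly k[n]}.
Implicit Types (F P : free_seq k n) (I J : S -> Prop).

Definition bounded I r : Prop :=
  exists F, [/\ graded F, resolves I F &
    forall i (a : 'I_(rank F i)), (gen a <= i + r)%N].

Lemma bounded_ext I J r : (forall f, I f <-> J f) -> bounded I r -> bounded J r.
Proof.
move=> IJ [F [gF [hI ex0 exS] bF]]; exists F; split=> //; split=> // f.
by rewrite -IJ.
Qed.

Lemma bounded_leq I r s : (r <= s)%N -> bounded I r -> bounded I s.
Proof.
move=> rs [F [gF rF bF]]; exists F; split=> // i a.
by apply: leq_trans (bF i a) _; rewrite leq_add2l.
Qed.

Lemma minimal_gen_bounded I r F i (a : 'I_(rank F i)) :
  minimal_graded_free_resolution I F -> bounded I r -> (gen a <= i + r)%N.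
Proof. by move=> mF [P [gP rP bP]]; have [b ->] := minimal_gen a mF gP rP. Qed.

(** The comparison theorem: the inclusion lifts to the generators, then degree by degree through
    exactness of the target. *)
Lemma graded_chain_map I J F P :
    graded F -> resolves I F -> graded P -> resolves J P ->
    (forall f, I f -> J f) ->
  exists phi : forall i, 'M[S]_(rank F i, rank P i),
    [/\ forall i, graded_mx (@gen k n F i) (@gen k n P i) (phi i),
        aug F = phi 0%N *m aug P &
        forall i, diff F i *m phi i = phi i.+1 *m diff P i].
Proof.
move=> gF rF gP rP IJ.
have [|phi0 gphi0 phi0P] :=
    graded_lift (graded_adiff (i := 0) gP) (graded_adiff (i := 0) gF).
  apply: factors_mx => a; apply/(factors_aug _ rP)/IJ/(factors_aug _ rF).
  exact: factors_row.
pose good i X (Y : 'M[S]_(rank F i.+1, rank P i.+1)) :=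
  graded_mx (@gen k n F i.+1) (@gen k n P i.+1) Y /\
  diff F i *m X = Y *m diff P i.
(* Each component is chosen from the previous one; that the choices are good is proved afterwards by
   induction. *)
pose phi := nat_rect (fun i => 'M[S]_(rank F i, rank P i)) phi0
  (fun i X => epsilon (inhabits 0) (good i X)).
have phiS i : graded_mx (@gen k n F i) (@gen k n P i) (phi i) ->
    diff F i *m phi i *m adiff P i = 0 -> good i (phi i) (phi i.+1).
  move=> gphi zero; apply: (epsilon_spec (inhabits 0) (good i (phi i))).
  have [|Y gY hY] := graded_lift (graded_adiff (i := i.+1) gP)
    (graded_mxM (graded_adiff (i := i.+1) gF) gphi).
    exact: exact_lift (exact_adiff (i := i) rP) zero.
  by exists Y.
have FF i : adiff F i.+1 *m adiff F i = 0.
  by apply: exact_comp; apply: exact_adiff rF.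
have all i : graded_mx (@gen k n F i) (@gen k n P i) (phi i) /\
    good i (phi i) (phi i.+1).
  elim: i => [|i [_ [gi hi]]].
    split=> //; apply: phiS => //; rewrite -mulmxA -phi0P; exact: (FF 0%N).
  split=> //; apply: phiS => //; rewrite -mulmxA -hi mulmxA.
  by rewrite (FF i.+1) mul0mx.
by exists phi; split=> // i; case: (all i) => // _ [].
Qed.

End Bounded.

Section Cone.
Variables (k : fieldType) (n : nat) (v : 'I_n).
Local Notation S := {mpoly k[n]}.
Variables (A M J : S -> Prop) (FA FM : free_seq k n).
Hypotheses (A_colon_v : forall f, M f -> A ('X_v * f) -> A f)
  (defJ : forall f, J f <-> exists a m, [/\ A a, M m & f = a + 'X_v * m]).
Hypotheses (gFA : graded FA) (rFA : resolves A FA).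
Hypotheses (gFM : graded FM) (rFM : resolves M FM).
Variable phi : forall i, 'M[S]_(rank FA i, rank FM i).
Hypotheses (gphi : forall i, graded_mx (@gen k n FA i) (@gen k n FM i) (phi i))
  (phi_aug : aug FA = phi 0%N *m aug FM)
  (phi_diff : forall i, diff FA i *m phi i = phi i.+1 *m diff FM i).

(* [crank], [cgen] and [cdiff] describe FA(-1) moved up by one homological
   degree, with 0 in degree 0. *)
Definition crank i := if i is j.+1 then rank FA j else 0%N.

Definition cgen i : 'I_(crank i) -> nat :=
  if i is j.+1 then fun a : 'I_(rank FA j) => (gen a).+1 else fun=> 0%N.

Definition cdiff i : 'M[S]_(crank i.+1, crank i) :=
  if i is j.+1 then diff FA j else 0.

(** The mapping cone of A(-1) -> A (+) M(-1), f |-> (x_v f, -f), lifted to resolutions by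
    multiplication by ['X_v] and by [- phi]. The blocks are FA, FM(-1), and FA(-1) moved up by
    one. *)
Definition cone : free_seq k n :=
  @FreeSeq k n (fun i => rank FA i + (rank FM i + crank i))%N
    (fun i => gcat (@gen k n FA i)
                (gcat (fun a : 'I_(rank FM i) => (gen a).+1) (@cgen i)))
    (col_mx (aug FA) (col_mx ('X_v *: aug FM) (0 : 'M_(crank 0, 1))))
    (fun i => col_mx (row_mx (diff FA i) 0)
                (col_mx (row_mx 0 (row_mx (diff FM i) 0))
                   (row_mx ('X_v *: 1%:M) (row_mx (- phi i) (- cdiff i))))).

Lemma graded_cdiff i : graded_mx (@cgen i.+1) (@cgen i) (cdiff i).
Proof.
case: i => [|i] a b t /=; first by rewrite mxE msupp0.
by case: gFA => _ g; rewrite addnS => /g ->.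
Qed.

Lemma graded_mxS p q (g1 : 'I_p -> nat) (g0 : 'I_q -> nat) (D : 'M[S]_(p, q)) :
  graded_mx g1 g0 D -> graded_mx (fun a => (g1 a).+1) (fun a => (g0 a).+1) D.
Proof. by move=> gD a b t /gD <-; rewrite addnS. Qed.

Lemma cone_graded : graded cone.
Proof.
split=> [|i].
  suff gcaug : graded_mx (@gen k n cone 0) (fun=> 0%N) (aug cone).
    by move=> a t /gcaug; rewrite addn0.
  apply: graded_col_mx; first exact: (graded_adiff (i := 0) gFA).
  apply: graded_col_mx; last exact: graded_mx0.
  exact/graded_mxX/(graded_adiff (i := 0) gFM).
apply: graded_col_mx.
  apply: graded_row_mx; last exact: graded_mx0.
  exact: (graded_adiff (i := i.+1) gFA).
apply: graded_col_mx.
  apply: graded_row_mx; first exact: graded_mx0.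
  apply: graded_row_mx; last exact: graded_mx0.
  exact/graded_mxS/(graded_adiff (i := i.+1) gFM).
apply: graded_row_mx; first exact/graded_mxX/graded_mx1.
apply: graded_row_mx; apply: graded_mxN; first exact/graded_mxS/gphi.
exact: (@graded_cdiff i).
Qed.

Lemma mul_cone_aug (u1 : 'rV_(rank FA 0)) (u2 : 'rV_(rank FM 0)) u3 :
  row_mx u1 (row_mx u2 u3) *m aug cone = u1 *m aug FA + 'X_v *: (u2 *m aug FM).
Proof. by rewrite /= !mul_row_col mulmx0 addr0 scalemxAr. Qed.

Lemma mul_cone_diff i (u1 : 'rV_(rank FA i.+1)) (u2 : 'rV_(rank FM i.+1))
    (u3 : 'rV_(rank FA i)) :
  row_mx u1 (row_mx u2 u3) *m diff cone i =
  row_mx (u1 *m diff FA i + 'X_v *: u3)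
    (row_mx (u2 *m diff FM i - u3 *m phi i) (- (u3 *m cdiff i))).
Proof.
rewrite /= !mul_row_col !mul_mx_row !mulmx0 !add_row_mx !add0r.
by rewrite !mulmxN -scalemxAr mulmx1.
Qed.

Lemma row_mx_split (p q r : nat) (u : 'rV[S]_(p + (q + r))) :
  exists u1 u2 u3, u = row_mx u1 (row_mx u2 u3).
Proof.
by exists (lsubmx u), (lsubmx (rsubmx u)), (rsubmx (rsubmx u)); rewrite !hsubmxK.
Qed.

Lemma X_scale_inj p (u : 'rV[S]_p) : 'X_v *: u = 0 -> u = 0.
Proof.
move/rowP=> h; apply/rowP => a; have /eqP := h a.
rewrite !mxE mulf_eq0 => /orP[|/eqP //].
by move/eqP/mpolyP/(_ U_(v)%MM)/eqP; rewrite mcoeffX mcoeff0 eqxx oner_eq0.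
Qed.

Lemma cone_aug_mem f : J f <-> exists u : 'rV_(rank cone 0), f = (u *m aug cone) 0 0.
Proof.
case: rFA => hA _ _; case: rFM => hM _ _; rewrite defJ; split=> [|[u ->]].
  case=> _ [_ [/hA[u1 ->] /hM[u2 ->] ->]].
  exists (row_mx u1 (row_mx u2 0)); rewrite mul_cone_aug.
  by apply/esym; rewrite mxE; congr (_ + _); rewrite mxE.
have [u1 [u2 [u3 ->]]] := row_mx_split u.
exists ((u1 *m aug FA) 0 0), ((u2 *m aug FM) 0 0).
split; [by apply/hA; exists u1|by apply/hM; exists u2|].
by rewrite mul_cone_aug mxE; congr (_ + _); rewrite mxE.
Qed.

Lemma cone_exact0 : exact (diff cone 0) (aug cone).
Proof.
have exA : exact (diff FA 0) (aug FA) by case: rFA.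
have exM : exact (diff FM 0) (aug FM) by case: rFM.
move=> u; split=> [|[w ->]]; last first.
  have [w1 [w2 [w3 ->]]] := row_mx_split w.
  rewrite mul_cone_diff mul_cone_aug mulmxDl mulmxBl -!mulmxA.
  rewrite (exact_comp exA) (exact_comp exM) -phi_aug !mulmx0 add0r sub0r.
  by rewrite -scalemxAl scalerN subrr.
have [u1 [u2 [u3 ->]]] := row_mx_split u.
rewrite mul_cone_aug => u0.
(* ['X_v] times the left side equals [u1 *m aug FA], which lies in [A]; the colon hypothesis then
   cancels ['X_v]. *)
have [w3 hw3] : exists w3, - (u2 *m aug FM) = w3 *m aug FA.
  apply/(factors_aug _ rFA); apply: A_colon_v.
    by apply/(factors_aug _ rFM); exists (- u2); rewrite mulNmx.
  rewrite mxE mulrN; move/eqP: u0; rewrite addr_eq0 => /eqP u0.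
  have <- : (u1 *m aug FA) 0 0 = - ('X_v * (u2 *m aug FM) 0 0).
    by rewrite u0 !mxE.
  by apply/(factors_aug _ rFA); exists u1.
have /exA[w1 hw1] : (u1 - 'X_v *: w3) *m aug FA = 0.
  by rewrite mulmxBl -scalemxAl -hw3 scalerN opprK.
have /exM[w2 hw2] : (u2 + w3 *m phi 0%N) *m aug FM = 0.
  by rewrite mulmxDl -mulmxA -phi_aug -hw3 subrr.
exists (row_mx w1 (row_mx w2 w3)); rewrite mul_cone_diff -hw1 -hw2 subrK addrK.
(* The third block is empty in homological degree 0. *)
by congr (row_mx _ (row_mx _ _)); apply/rowP => -[].
Qed.

Lemma cone_exactS i : exact (diff cone i.+1) (diff cone i).
Proof.
have exA j : exact (diff FA j.+1) (diff FA j) by exact: (exact_adiff (i := j.+1) rFA).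
have exM j : exact (diff FM j.+1) (diff FM j) by exact: (exact_adiff (i := j.+1) rFM).
have exA0 : exact (diff FA 0) (aug FA) by case: rFA.
move=> u; split=> [|[w ->]]; last first.
  have [w1 [w2 [w3 ->]]] := row_mx_split w.
  rewrite mul_cone_diff mul_cone_diff mulmxDl mulmxBl -!mulmxA.
  rewrite (exact_comp (exA i)) (exact_comp (exM i)) !mulmx0 add0r sub0r.
  rewrite -scalemxAl scalerN subrr mulNmx opprK -mulmxA phi_diff addNr.
  have zero : cdiff i.+1 *m cdiff i = 0.
    by case: i {u w w1 w2 w3} => [|i]; [rewrite mulmx0|apply: exact_comp (exA i)].
  rewrite -[RHS]row_mx0 -[X in _ = row_mx _ X]row_mx0.
  congr (row_mx _ (row_mx _ _)); rewrite mulNmx opprK -mulmxA.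
  exact: etrans (congr1 (mulmx w3) zero) (mulmx0 _ _).
have [u1 [u2 [u3 ->]]] := row_mx_split u.
rewrite mul_cone_diff => u0.
have /eq_row_mx[e1 /eq_row_mx[e2 e3]] := etrans u0
  (esym (etrans (congr1 (row_mx 0) (row_mx0 _ _ _ _)) (row_mx0 _ _ _ _))).
(* For positive [i] the third block says that [u3] is a cycle. For [i = 0] that block is empty, and
   [e1] gives this instead, after applying [aug FA] and cancelling ['X_v]. *)
have [w3 hw3] : exists w3, - u3 = w3 *m diff FA i.
  case: i u u1 u2 u3 {u0} e1 e2 e3 => [|i] u u1 u2 u3 e1 _ e3; last first.
    by apply/exA; rewrite mulNmx.
  apply/exA0; apply: X_scale_inj.
  have /eqP := congr1 (mulmx^~ (aug FA)) e1.
  rewrite mulmxDl -mulmxA (exact_comp exA0) mulmx0 add0r mul0mx -scalemxAl.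
  by move/eqP=> e; rewrite mulNmx scalerN e oppr0.
have /exA[w1 hw1] : (u1 - 'X_v *: w3) *m diff FA i = 0.
  by rewrite mulmxBl -scalemxAl -hw3 scalerN opprK.
have /exM[w2 hw2] : (u2 + w3 *m phi i.+1) *m diff FM i = 0.
  by rewrite mulmxDl -mulmxA -phi_diff mulmxA -hw3 mulNmx.
exists (row_mx w1 (row_mx w2 w3)); rewrite mul_cone_diff -hw1 -hw2 subrK addrK.
by rewrite -[w3 *m cdiff _]hw3 opprK.
Qed.

Lemma cone_resolves : resolves J cone.
Proof.
split; first exact: cone_aug_mem; first exact: cone_exact0.
exact: cone_exactS.
Qed.

End Cone.

(** * Monomial ideals *)

(** The degree shift of M is absorbed by [s < r]; that of the copy A(-1) is offset by its rise in
    homological degree. *)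
Lemma bounded_cone (k : fieldType) n (v : 'I_n) (A M J : {mpoly k[n]} -> Prop) r s :
    (forall f, A f -> M f) ->
    (forall f, M f -> A ('X_v * f) -> A f) ->
    (forall f, J f <-> exists a m, [/\ A a, M m & f = a + 'X_v * m]) ->
  bounded A r -> bounded M s -> (s < r)%N -> bounded J r.
Proof.
move=> AM Av defJ [FA [gFA rFA bA]] [FM [gFM rFM bM]] sr.
have [phi [gphi phi_aug phi_diff]] := graded_chain_map gFA rFA gFM rFM AM.
exists (cone v phi); split.
- exact: cone_graded.
- exact: (cone_resolves Av defJ rFA rFM phi_aug phi_diff).
move=> i a; rewrite /= /gcat; case: split => [//|c]; case: split => {a c} [a|].
  by rewrite (leq_trans _ (_ : i + s.+1 <= _)%N) ?leq_add2l // addnS ltnS.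
by case: i => [[]//|i] a /=; rewrite addSn ltnS.
Qed.

Section MonomialIdeals.
Variables (k : fieldType) (n : nat).
Local Notation S := {mpoly k[n]}.
Implicit Types (P Q : pred 'X_{1..n}).

Definition mideal P (f : S) : Prop := forall t, t \in msupp f -> P t.

Lemma mideal_sum P (I : eqType) (s : seq I) (c : I -> k) (t : I -> 'X_{1..n}) :
  (forall i, i \in s -> P (t i)) -> mideal P (\sum_(i <- s) c i *: 'X_[t i]).
Proof.
move=> h u /msupp_sum_le /flattenP [l /mapP[i]].
rewrite filter_predT => /h Pt -> /msuppZ_le /mem_msuppXP <-; exact: Pt.
Qed.

(** Invariance of [P] under adding [U_(v)] says that [x_v] is a nonzerodivisor modulo the ideal of
    [P]. *)
Lemma bounded_mideal_cone P Q v r s :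
    (forall t, P t -> Q t) -> (forall t, P (t + U_(v))%MM = P t) ->
    bounded (mideal P) r -> bounded (mideal Q) s -> (s < r)%N ->
  bounded (mideal (fun t => P t || (0 < t v)%N && Q (t - U_(v))%MM)) r.
Proof.
move=> PQ Pv bP bQ sr; apply: (@bounded_cone _ _ v _ _ _ r s _ _ _ bP bQ sr).
- by move=> f hf t /hf /PQ.
- move=> f _ hf t tf; rewrite -Pv; apply: hf.
  by rewrite mcoeff_msupp mulrC addmC mcoeffMX -mcoeff_msupp.
move=> f; split=> [hf|[a [m [ha hm ->]]] t]; last first.
  move/msuppD_le; rewrite mem_cat => /orP[/ha -> //|].
  move/msuppM_le => /allpairsP [[t1 t2] /= [/mem_msuppXP <- t2m ->]].
  by rewrite mnmDE mnm1E eqxx /= addmC addmK (hm _ t2m) orbT.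
(* The terms of [f] are sorted by [P]; those that fail [P] are divisible by [x_v]. *)
exists (\sum_(t <- [seq t <- msupp f | P t]) f@_t *: 'X_[t]).
exists (\sum_(t <- [seq t <- msupp f | ~~ P t]) f@_t *: 'X_[t - U_(v)%MM]).
split.
- by apply: mideal_sum => t; rewrite mem_filter => /andP[].
- apply: mideal_sum => t; rewrite mem_filter => /andP[nP /hf].
  by rewrite (negPf nP) => /andP[].
rewrite {1}[f]mpolyE (bigID P) /= !big_filter; congr (_ + _).
rewrite mulr_sumr big_seq_cond [RHS]big_seq_cond; apply: eq_bigr => t.
case/andP => /hf tf nP; move: tf; rewrite (negPf nP) /= => /andP[tv _].
rewrite -scalerAr -mpolyXD addmC submK //; apply/mnm_lepP => i.
by rewrite mnm1E; case: eqP => // <-.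
Qed.

Lemma bounded_pred0 r : bounded (mideal pred0) r.
Proof.
exists (@FreeSeq k n (fun=> 0%N) (fun _ _ => 0%N) 0 (fun=> 0)).
split=> //; first by split=> [[]|i []].
split=> [f|u|i u]; last 2 first.
1-2: by split=> _; [exists 0; apply/rowP => -[]|rewrite mulmx0].
split=> [hf|[u ->] t]; last by rewrite mulmx0 mxE msupp0.
exists 0; rewrite mul0mx mxE; apply/eqP; rewrite -msupp_eq0.
by rewrite /mideal in hf; case: (msupp f) hf => // t s /(_ t (mem_head _ _)).
Qed.

Lemma bounded_predT : bounded (mideal predT) 0.
Proof.
exists (@FreeSeq k n (fun i => if i is 0 then 1%N else 0%N) (fun _ _ => 0%N)
  1%:M (fun=> 0)).
split=> //.
  split=> [a t /=|i []//]; rewrite (ord1 a) mxE eqxx msupp1 inE => /eqP ->.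
  exact: mdeg0.
split=> [f|u|i u]; last first.
- by split=> _; [exists 0; apply/rowP => -[]|rewrite mulmx0].
- rewrite mulmx1; split=> [->|[w ->]]; last by rewrite mulmx0.
  by exists 0; rewrite mulmx0.
split=> // _; exists f%:M; by rewrite mulmx1 mxE mulr1n.
Qed.

End MonomialIdeals.

(** * Extension of scalars *)

Section BaseChange.
Variables (k : fieldType) (m n : nat) (iota : 'I_m -> 'I_n).
Hypothesis iota_inj : injective iota.
Local Notation S := {mpoly k[n]}.

(** A monomial of k[n] splits uniquely into a part away from the image of [iota], [mnm_off], and the
    push of its [mnm_pull]; hence k[n] is free over k[m]. *)
Definition mnm_pull (s : 'X_{1..n}) : 'X_{1..m} := [multinom s (iota i) | i < m].

Definition mnm_push (t : 'X_{1..m}) : 'X_{1..n} := (\sum_i U_(iota i) *+ t i)%MM.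

Definition mnm_off (s : 'X_{1..n}) : 'X_{1..n} :=
  [multinom if j \in codom iota then 0%N else s j | j < n].

Lemma mnm_push_iota t i : mnm_push t (iota i) = t i.
Proof.
rewrite mnm_sumE (bigD1 i) //= mulmnE mnm1E eqxx mul1n big1 ?addn0 // => j nij.
by rewrite mulmnE mnm1E (inj_eq iota_inj) (negPf nij).
Qed.

Lemma mnm_push_notin t j : j \notin codom iota -> mnm_push t j = 0%N.
Proof.
move=> nj; rewrite mnm_sumE big1 // => i _; rewrite mulmnE mnm1E.
by case: eqP nj => // <-; rewrite codom_f.
Qed.

Lemma mnm_pullD s t : mnm_pull (s + mnm_push t) = (mnm_pull s + t)%MM.
Proof. by apply/mnmP => i; rewrite mnmE !mnmDE mnmE mnm_push_iota. Qed.

Lemma mnm_offD s t : mnm_off (s + mnm_push t) = mnm_off s.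
Proof.
apply/mnmP => j; rewrite !mnmE; case: ifP => // /negbT nj.
by rewrite mnm_push_notin ?addn0.
Qed.

Lemma mnm_off_pull s : (mnm_off s + mnm_push (mnm_pull s))%MM = s.
Proof.
apply/mnmP => j; rewrite mnmDE mnmE; case: (boolP (j \in codom iota)) => [|nj].
  by case/codomP => i ->; rewrite mnm_push_iota mnmE.
by rewrite mnm_push_notin ?addn0.
Qed.

Lemma mdeg_push t : mdeg (mnm_push t) = mdeg t.
Proof.
rewrite mdeg_sum [RHS]mdegE; apply: eq_bigr => i _.
by rewrite mdegMn mdeg1 mul1n.
Qed.

Definition mpoly_push : {rmorphism {mpoly k[m]} -> S} :=
  comp_mpoly [tuple 'X_(iota i) | i < m].

Lemma mpoly_pushZ c p : mpoly_push (c *: p) = c *: mpoly_push p.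
Proof. exact: comp_mpolyZ. Qed.

Lemma mpoly_pushX t : mpoly_push 'X_[t] = 'X_[mnm_push t].
Proof.
rewrite [LHS]comp_mpolyX /mnm_push.
rewrite -(big_map (fun i => U_(iota i) *+ t i)%MM xpredT id) -mpolyX_prod big_map.
by apply: eq_bigr => i _; rewrite tnth_mktuple mpolyXn.
Qed.

Lemma mideal_push (P : pred _) p : (forall t, t \in msupp p -> P (mnm_push t)) ->
  mideal P (mpoly_push p).
Proof.
move=> h; rewrite [p]mpolyE raddf_sum /=.
under eq_bigr do rewrite mpoly_pushZ mpoly_pushX.
exact: mideal_sum.
Qed.

Lemma graded_push p q (g1 : 'I_p -> nat) (g0 : 'I_q -> nat)
    (D : 'M[{mpoly k[m]}]_(p, q)) :
  graded_mx g1 g0 D -> graded_mx g1 g0 (map_mx mpoly_push D).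
Proof.
move=> gD a b t; rewrite mxE => tD; apply/eqP.
apply: (@mideal_push (fun t => mdeg t + g0 b == g1 a)%N) tD => {}t tD.
by rewrite mdeg_push (gD _ _ _ tD).
Qed.

(* k[n] is free over k[m], with basis the monomials [mu] in the variables
   outside the image of [iota]; this is the coordinate along [mu]. *)
Definition coord (mu : 'X_{1..n}) : S -> {mpoly k[m]} :=
  mlin (fun s => if mnm_off s == mu then 'X_[mnm_pull s] else 0).

HB.instance Definition _ mu := GRing.Linear.on (coord mu).

(** Coordinates are k[m]-linear because multiplying by a pushed monomial leaves [mnm_off]
    unchanged. *)
Lemma coordM mu p q : coord mu (p * mpoly_push q) = coord mu p * q.
Proof.
apply: mlinMr => s; rewrite [q in LHS]mpolyE raddf_sum mulr_sumr linear_sum /=.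
rewrite [q in RHS]mpolyE mulr_sumr; apply: eq_bigr => t _.
rewrite mpoly_pushZ mpoly_pushX -!scalerAr linearZ /= -mpolyXD mlinX mnm_offD.
by case: eqP => _; rewrite ?mnm_pullD ?mpolyXD ?mul0r.
Qed.

Lemma coord_decomp (L : seq 'X_{1..n}) f :
    uniq L -> {subset map mnm_off (msupp f) <= L} ->
  f = \sum_(mu <- L) 'X_[mu] * mpoly_push (coord mu f).
Proof.
move=> uL sL; rewrite {1}[f]mpolyE.
have coordE mu : 'X_[mu] * mpoly_push (coord mu f) =
    \sum_(s <- msupp f) if mnm_off s == mu then f@_s *: 'X_[s] else 0.
  rewrite /coord /mlin raddf_sum mulr_sumr; apply: eq_bigr => s _ /=.
  rewrite mpoly_pushZ -scalerAr; case: eqP => [<-|_].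
    by rewrite mpoly_pushX -mpolyXD mnm_off_pull.
  by rewrite raddf0 mulr0 scaler0.
under [RHS]eq_bigr do rewrite coordE.
rewrite exchange_big; apply: eq_big_seq => s sf /=.
rewrite (bigD1_seq (mnm_off s)) ?eqxx ?sL ?map_f //= big1 ?addr0 // => mu.
by rewrite eq_sym => /negPf->.
Qed.

Lemma map_coordM mu p q (u : 'M[S]_(p, q)) r (A : 'M[{mpoly k[m]}]_(q, r)) :
  map_mx (coord mu) (u *m map_mx mpoly_push A) = map_mx (coord mu) u *m A.
Proof.
apply/matrixP => a b; rewrite !mxE raddf_sum; apply: eq_bigr => c _ /=.
by rewrite !mxE coordM.
Qed.

Lemma map_coord_decomp r (u : 'rV[S]_r) : exists L, u =
  \sum_(mu <- L) 'X_[mu] *: map_mx mpoly_push (map_mx (coord mu) u).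
Proof.
exists (undup (flatten [seq map mnm_off (msupp (u 0 b)) | b <- enum 'I_r])).
apply/rowP => b; rewrite summxE [LHS](@coord_decomp (undup (flatten
  [seq map mnm_off (msupp (u 0 b)) | b <- enum 'I_r]))) ?undup_uniq //.
  by apply: eq_bigr => mu _; rewrite !mxE.
move=> s sb; rewrite mem_undup; apply/flattenP.
by exists (map mnm_off (msupp (u 0 b))) => //; apply: map_f; rewrite mem_enum.
Qed.

Lemma factors_push p q (D : 'M[{mpoly k[m]}]_(p, q)) (u : 'rV[S]_q) :
  factors (map_mx mpoly_push D) u <-> forall mu, factors D (map_mx (coord mu) u).
Proof.
split=> [[w ->] mu|h]; first by exists (map_mx (coord mu) w); rewrite map_coordM.
have [L ->] := map_coord_decomp u; apply: factors_sum => mu _.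
by apply: factors_scale; have [w ->] := h mu; rewrite map_mxM; exists (map_mx mpoly_push w).
Qed.

(** Flatness: kernels and images of pushed matrices are both tested coordinate by coordinate over
    the free basis. *)
Lemma exact_push p q r (D' : 'M[{mpoly k[m]}]_(r, p)) (D : 'M_(p, q)) :
  exact D' D -> exact (map_mx mpoly_push D') (map_mx mpoly_push D).
Proof.
move=> ex u; rewrite factors_push; split=> [uD mu|h].
  by apply/ex; rewrite -map_coordM uD map_mx0.
have [L ->] := map_coord_decomp (u *m map_mx mpoly_push D).
rewrite big1 // => mu _; rewrite map_coordM.
by have /ex -> := h mu; rewrite map_mx0 scaler0.
Qed.

Lemma mideal_coord (P : pred _) f :
  mideal (fun s => P (mnm_pull s)) f <-> forall mu, mideal P (coord mu f).
Proof.
split=> [hf mu|h s].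
  rewrite /coord /mlin (bigID (fun s => mnm_off s == mu)) /=.
  rewrite [X in _ + X]big1 ?addr0; last first.
    by move=> s /negPf ->; rewrite scaler0.
  under eq_bigr => s -> do [].
  rewrite -big_filter; apply: mideal_sum => s.
  by rewrite mem_filter => /andP[_ /hf].
rewrite mcoeff_msupp => nz; apply: (h (mnm_off s)); rewrite mcoeff_msupp.
rewrite (@mcoeff_mlin_monomial _ _ _ _ (fun s' => mnm_off s' == mnm_off s)) //.
move=> a b /eqP offa /eqP offb ab.
by rewrite -[a]mnm_off_pull -[b]mnm_off_pull offa offb ab.
Qed.

(** The pushed resolution keeps its ranks and degrees, since renaming variables preserves degree. *)
Lemma bounded_base_change (P : pred _) r :
  bounded (@mideal k m P) r -> bounded (@mideal k n (fun s => P (mnm_pull s))) r.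
Proof.
case=> F [gF rF bF].
exists (@FreeSeq k n (rank F) (@gen k m F) (map_mx mpoly_push (aug F))
  (fun i => map_mx mpoly_push (diff F i))).
split=> //.
  split=> [a t|i a b t]; last exact: (graded_push (graded_adiff (i := i.+1) gF)).
  by move/(graded_push (graded_adiff (i := 0) gF)); rewrite addn0.
split=> [f|u|i u].
- rewrite mideal_coord; transitivity (factors (map_mx mpoly_push (aug F)) f%:M).
    rewrite factors_push; split=> h mu; have := h mu.
      by rewrite (factors_aug _ rF) !mxE mulr1n.
    by rewrite (factors_aug _ rF) !mxE mulr1n.
  split=> -[w hw]; exists w; first by rewrite -hw mxE mulr1n.
  by apply/rowP => i; rewrite ord1 hw mxE mulr1n.
- exact: (exact_push (exact_adiff (i := 0) rF)).
exact: (exact_push (exact_adiff (i := i.+1) rF)).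
Qed.

End BaseChange.

(** * Nonedge ideals and regularity *)

Section NonedgeMonomials.
Variables (k : fieldType) (n : nat) (ne : rel 'I_n).
Hypotheses (ne_sym : ssrbool.symmetric ne) (ne_irr : irreflexive ne).
Implicit Types (W L : {set 'I_n}) (t : 'X_{1..n}).

(** The monomials of the ideal generated by the nonedge products inside [W] and the variables in
    [L]; a nonempty [L] arises from colon ideals. *)
Definition nonedge_mnm W L : pred 'X_{1..n} := fun t =>
  [exists i in W, exists j in W, [&& ne i j, 0 < t i & 0 < t j]%N]
  || [exists i in L, 0 < t i]%N.

Lemma nonedge_mnmP W L t :
  reflect ((exists i j, [/\ i \in W, j \in W, ne i j, (0 < t i)%N & (0 < t j)%N])
           \/ (exists2 i, i \in L & (0 < t i)%N))
          (nonedge_mnm W L t).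
Proof.
apply: (iffP orP) => -[h|h]; [left|right|left|right].
- case/exists_inP: h => i Wi /exists_inP[j Wj /and3P[]].
  by exists i, j.
- exact/exists_inP.
- case: h => i [j [Wi Wj ij ti tj]]; apply/exists_inP; exists i => //.
  by apply/exists_inP; exists j => //; rewrite ij ti.
exact/exists_inP.
Qed.

Lemma eq_nonedge_mnm W L t t' :
  {in W :|: L, t =1 t'} -> nonedge_mnm W L t = nonedge_mnm W L t'.
Proof.
move=> tt'; congr (_ || _).
  apply: eq_existsb => i; case: (boolP (i \in W)) => //= Wi.
  apply: eq_existsb => j; case: (boolP (j \in W)) => //= Wj.
  by rewrite !tt' // inE ?Wi ?Wj.
apply: eq_existsb => i; case: (boolP (i \in L)) => //= Li.
by rewrite tt' // inE Li orbT.
Qed.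

Lemma nonedge_mnmDU W L v t :
  v \notin W -> v \notin L -> nonedge_mnm W L (t + U_(v))%MM = nonedge_mnm W L t.
Proof.
move=> vW vL; apply: eq_nonedge_mnm => j jWL; rewrite mnmDE mnm1E.
case: eqP jWL => [<-|_]; last by rewrite addn0.
by rewrite inE (negPf vW) (negPf vL).
Qed.

Lemma nonedge_mnmBU W L v t :
  v \notin W -> v \notin L -> nonedge_mnm W L (t - U_(v))%MM = nonedge_mnm W L t.
Proof.
move=> vW vL; apply: eq_nonedge_mnm => j jWL; rewrite mnmBE mnm1E.
case: eqP jWL => [<-|_]; last by rewrite subn0.
by rewrite inE (negPf vW) (negPf vL).
Qed.

Local Notation bdd W L := (bounded (@mideal k n (nonedge_mnm W L))).

Lemma bounded_eq_mideal (P Q : pred 'X_{1..n}) r :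
  P =1 Q -> bounded (@mideal k n P) r -> bounded (@mideal k n Q) r.
Proof.
move=> PQ; apply: bounded_ext => f.
by split=> h t /h; rewrite PQ.
Qed.

(** The cone with the unit ideal, which is 0-bounded; its condition [s < r] becomes [0 < r]. *)
Lemma bounded_add_var W L y r : y \notin W -> y \notin L -> (0 < r)%N ->
  bdd W L r -> bdd W (y |: L) r.
Proof.
move=> yW yL r0 bWL.
apply: bounded_eq_mideal (bounded_mideal_cone (v := y) _ _ bWL (bounded_predT k n) r0).
- move=> t; rewrite andbT; apply/orP/nonedge_mnmP.
    case=> [/nonedge_mnmP[]|ty]; first by left.
      by case=> i Li ti; right; exists i => //; rewrite !inE Li orbT.
    by right; exists y; rewrite ?setU11.
  case=> [h|[i]]; first by left; apply/nonedge_mnmP; left.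
  rewrite !inE => /orP[/eqP->|Li ti]; first by right.
  by left; apply/nonedge_mnmP; right; exists i.
- by [].
by move=> t; apply: nonedge_mnmDU.
Qed.

Lemma bounded_add_vars W L r : [disjoint W & L] -> (0 < r)%N ->
  bdd W set0 r -> bdd W L r.
Proof.
move=> + r0 bW; move: {2}#|L| (erefl #|L|) => c.
elim: c L => [|c IH] L; first by move/eqP; rewrite cards_eq0 => /eqP ->.
move=> cL dWL; have [y yL] : exists y, y \in L.
  by apply/set0Pn; rewrite -cards_eq0 cL.
rewrite -(setD1K yL); apply: bounded_add_var => //.
- by rewrite (disjointFl dWL yL).
- by rewrite !inE eqxx.
apply: IH; first by move: cL; rewrite (cardsD1 y) yL => -[].
by apply: disjointWr dWL; apply: subD1set.
Qed.

(* The cone is applied to M = (J : x_v), where J is the nonedge ideal of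
   v |: W: the set N of neighbours of v in W contributes the nonedges of M, and
   the set L of non-neighbours contributes variables. *)
Lemma bounded_add_vertex W v r s : v \notin W -> (0 < s < r)%N ->
    bdd W set0 r -> bdd [set i in W | ~~ ne v i] set0 s ->
  bdd (v |: W) set0 r.
Proof.
move=> vW /andP[s0 sr] bW; set N := [set i in W | _]; set L := [set i in W | ne v i].
move=> bN; have bNL : bdd N L s.
  apply: bounded_add_vars => //; rewrite -setI_eq0; apply/eqP/setP => i.
  by rewrite !inE; case: (ne v i); rewrite ?andbF.
have vN : v \notin N by rewrite inE (negPf vW).
have vL : v \notin L by rewrite inE (negPf vW).
have v0 : v \notin (set0 : {set 'I_n}) by rewrite inE.
apply: bounded_eq_mideal (bounded_mideal_cone (v := v) _ _ bW bNL sr); last first.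
- by move=> t; apply: nonedge_mnmDU.
(* A nonedge of [W] either has an end not adjacent to [v], whose variable is in [L], or lies inside
   [N]. *)
- move=> t /nonedge_mnmP[[i [j [Wi Wj ij ti tj]]]|[i]]; last by rewrite inE.
  apply/nonedge_mnmP; case: (boolP (ne v i)) => vi.
    by right; exists i => //; rewrite inE Wi.
  case: (boolP (ne v j)) => vj; first by right; exists j => //; rewrite inE Wj.
  by left; exists i, j; rewrite !inE Wi Wj.
move=> t; rewrite nonedge_mnmBU //; apply/orP/nonedge_mnmP.
  case=> [/nonedge_mnmP[]|/andP[tv /nonedge_mnmP[]]].
  - by case=> i [j [Wi Wj *]]; left; exists i, j; rewrite !inE Wi Wj !orbT.
  - by case=> i; rewrite inE.
  - case=> i [j [+ + ij ti tj]]; rewrite !inE => /andP[Wi _] /andP[Wj _].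
    by left; exists i, j; rewrite !inE Wi Wj !orbT.
  case=> i; rewrite inE => /andP[Wi vi] ti; left; exists v, i.
  by rewrite !inE eqxx Wi orbT.
case=> [|[i]]; last by rewrite inE.
have right_case i : i \in W -> ne v i -> (0 < t v)%N -> (0 < t i)%N ->
    (0 < t v)%N && nonedge_mnm N L t.
  move=> Wi vi tv ti; rewrite tv; apply/nonedge_mnmP; right; exists i => //.
  by rewrite inE Wi.
case=> i [j [+ + ij ti tj]]; rewrite !inE => /orP[/eqP iv|Wi] /orP[/eqP jv|Wj].
- by rewrite iv jv ne_irr in ij.
- by right; apply: (right_case j); rewrite -?iv.
- by right; apply: (right_case i); rewrite -?jv // ne_sym.
by left; apply/nonedge_mnmP; left; exists i, j.
Qed.

(** Adding vertices one at a time provides some resolution of every nonedge ideal; minimal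
    resolutions and finiteness of the regularity rest on it. *)
Lemma bounded_exists W : exists r, bdd W set0 r.
Proof.
have [c] := ubnP #|W|; elim: c W => // c IH W Wc.
have [->|[v vW]] := set_0Vmem W.
  exists 0%N; apply: bounded_eq_mideal (@bounded_pred0 k n 0) => t.
  by apply/esym/negbTE/negP => /nonedge_mnmP[[i [j []]]|[i]]; rewrite inE.
have W'c : (#|W :\ v| < c)%N by move: Wc; rewrite (cardsD1 v) vW.
have [r1 b1] := IH _ W'c.
have [|r2 b2] := IH [set i in W :\ v | ~~ ne v i].
  by apply: leq_ltn_trans W'c; apply/subset_leq_card/subsetP => i; rewrite inE => /andP[].
(* The inner [maxn] makes the smaller bound positive, and the successor makes the larger one
   strictly greater, as the cone requires. *)
exists (maxn r1 (maxn r2 1).+1); rewrite -(setD1K vW).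
apply: (@bounded_add_vertex _ _ _ (maxn r2 1)).
- by rewrite !inE eqxx.
- by rewrite !leq_max ltnSn leqnn !orbT.
- by apply: bounded_leq b1; rewrite leq_maxl.
by apply: bounded_leq b2; rewrite leq_maxl.
Qed.

End NonedgeMonomials.

(** * Graph ideals, and regularity as the least positive bound *)

Section GraphIdeals.
Variable k : fieldType.
Implicit Type G : sgraph.

Definition nonedge G : rel 'I_#|G| := fun i j =>
  (i != j) && ~~ edge (enum_val i) (enum_val j).

Lemma nonedge_sym G : ssrbool.symmetric (@nonedge G).
Proof. by move=> i j; rewrite /nonedge eq_sym edge_sym. Qed.

Lemma nonedge_irr G : irreflexive (@nonedge G).
Proof. by move=> i; rewrite /nonedge eqxx. Qed.

Lemma nonedge_idealE G (f : {mpoly k[#|G|]}) :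
  nonedge_ideal f <-> mideal (nonedge_mnm (@nonedge G) setT set0) f.
Proof.
split=> [[c ->] t|hf].
  case/msupp_sum_le/flattenP => l /mapP[e]; rewrite mem_filter => /andP[/andP[e12 ne] _] ->.
  case/msuppM_le/allpairsP => -[t1 t2] /= [_ + ->].
  rewrite -mpolyXD => /mem_msuppXP <-; apply/nonedge_mnmP; left.
  exists (enum_rank e.1), (enum_rank e.2).
  rewrite !inE /nonedge !enum_rankK (inj_eq enum_rank_inj) e12 ne.
  by rewrite !mnmDE !mnm1E !eqxx; split=> //; rewrite !(addnC _ 1%N, addnCA _ 1%N).
(* The ideal is closed under sums, so single terms suffice; each is a multiple of one generator,
   whose coefficient is the quotient monomial. *)
rewrite [f]mpolyE big_seq; apply: big_ind => [|_ _ [c1 ->] [c2 ->]|t /hf].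
- by exists (fun=> 0); rewrite big1 // => e _; rewrite mul0r.
- exists (fun e => c1 e + c2 e); rewrite -big_split.
  by apply: eq_bigr => e _; rewrite mulrDl.
case/nonedge_mnmP => [|[i]]; last by rewrite inE.
case=> i [j [_ _ /andP[ij nij] ti tj]].
pose e : G * G := (enum_val i, enum_val j).
exists (fun e' => if e' == e then f@_t *: 'X_[t - (U_(i) + U_(j))] else 0).
rewrite (bigD1 e) /=; last by rewrite (inj_eq enum_val_inj) ij.
rewrite eqxx big1 ?addr0 => [|e' /andP[_ /negPf->]]; last by rewrite mul0r.
rewrite !enum_valK -scalerAl -!mpolyXD submK //; apply/mnm_lepP => l.
rewrite mnmDE !mnm1E; move: ij ti tj; case: (i =P l) => [->|_].
  by rewrite eq_sym => /negPf ->.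
by case: (j =P l) => [->|].
Qed.

Definition bounded_graph G r := bounded (@nonedge_ideal k G) r.

Lemma bounded_graphE G r : bounded_graph G r <->
  bounded (@mideal k _ (nonedge_mnm (@nonedge G) setT set0)) r.
Proof.
split; apply: bounded_ext => f; first exact: nonedge_idealE.
exact: iff_sym (nonedge_idealE f).
Qed.

(** Scalar extension along the inclusion of the vertices of [A] turns the ideal of the induced graph
    into that of [W]. *)
Lemma bounded_induced G (A : {set G}) (W : {set 'I_#|G|}) r :
    (forall x, (enum_rank x \in W) = (x \in A)) -> bounded_graph (induced A) r ->
  bounded (@mideal k _ (nonedge_mnm (@nonedge G) W set0)) r.
Proof.
move=> WA /bounded_graphE; pose H := induced A.
pose iota (i : 'I_#|H|) : 'I_#|G| := enum_rank (val (enum_val i)).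
have iota_inj : injective iota.
  by move=> i j /enum_rank_inj /val_inj /enum_val_inj.
move/(bounded_base_change iota_inj); apply: bounded_eq_mideal => t.
have ne_iota i j : nonedge (iota i) (iota j) = nonedge i j.
  by rewrite /nonedge !enum_rankK (inj_eq iota_inj).
have iotaW i : iota i \in W by rewrite WA; apply: valP.
have iota_onto l : l \in W -> exists i, l = iota i.
  rewrite -(enum_valK l) WA => Al.
  by exists (enum_rank (exist _ (enum_val l) Al : H)); rewrite /iota enum_rankK.
apply/nonedge_mnmP/nonedge_mnmP; case=> [|[i]]; try by rewrite inE.
  case=> i [j [_ _ ij]]; rewrite !mnmE => ti tj; left.
  by exists (iota i), (iota j); rewrite ne_iota.
case=> _ [_ [/iota_onto[i ->] /iota_onto[j ->]]].
rewrite ne_iota => ij ti tj; left; exists i, j.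
by rewrite !inE !mnmE.
Qed.

(** A minimal resolution exists, so the [epsilon] in [betti] selects genuine Betti numbers. *)
Lemma betti_minimal G : exists2 F,
  minimal_graded_free_resolution (@nonedge_ideal k G) F &
  forall i j, betti (@nonedge_ideal k G) i j = #|[set a : 'I_(rank F i) | gen a == j]|.
Proof.
have [r /bounded_graphE[P [gP rP _]]] :=
  bounded_exists k (@nonedge_sym G) (@nonedge_irr G) setT.
have [F mF] := minimal_resolution_exists gP rP.
apply: (epsilon_spec _ (is_betti (@nonedge_ideal k G))).
by exists (fun i j => #|[set a : 'I_(rank F i) | gen a == j]|), F.
Qed.

Lemma max_nat_spec (P : nat -> Prop) m N : P m -> (forall r, P r -> (r <= N)%N) ->
  P (max_nat P) /\ forall r, P r -> (r <= max_nat P)%N.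
Proof.
move=> Pm PN; apply: (epsilon_spec _ (fun m => P m /\ forall r, P r -> (r <= m)%N)).
pose p r : bool := excluded_middle_informative (P r).
have pP r : reflect (P r) (p r) by rewrite /p; case: excluded_middle_informative; constructor.
have exp : exists r, p r by exists m; apply/pP.
have pN r : p r -> (r <= N)%N by move/pP/PN.
case: (ex_maxnP exp pN) => q /pP Pq qmax; exists q; split=> // r /pP; exact: qmax.
Qed.

Lemma regP G : ~~ is_complete G ->
  [/\ (0 < reg k G)%N, bounded_graph G (reg k G) &
      forall r, bounded_graph G r -> (reg k G <= r)%N].
Proof.
move=> ncG; have [F mF bettiE] := betti_minimal G.
rewrite /reg (negPf ncG); set P := fun r => _.
have PE r : P r <-> exists i (a : 'I_(rank F i)), gen a = (i + r)%N.
  split=> [[i /eqP]|[i [a ga]]].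
    rewrite bettiE cards_eq0 => /set0Pn[a]; rewrite inE => /eqP; by exists i, a.
  exists i; apply/eqP; rewrite bettiE cards_eq0; apply/set0Pn.
  by exists a; rewrite inE ga.
have Pbound r s : bounded_graph G s -> P r -> (r <= s)%N.
  move=> bs /PE[i [a ga]]; have := minimal_gen_bounded a mF bs.
  by rewrite ga leq_add2l.
have [N bN] := bounded_exists k (@nonedge_sym G) (@nonedge_irr G) setT.
move/bounded_graphE in bN.
have [x [y [nxy nexy]]] : exists x y : G, x != y /\ ~~ edge x y.
  move: ncG; rewrite negb_forall => /existsP[x]; rewrite negb_forall.
  by case/existsP=> y; rewrite negb_imply => /andP[]; exists x, y.
case: (mF) => gF rF _.
(* A nonedge makes the ideal nonzero, and the ideal contains no nonzero constant, so some generator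
   has positive degree. Hence the maximum exists and is positive. *)
have [a ga0] : exists a : 'I_(rank F 0), (0 < gen a)%N.
  pose f : {mpoly k[#|G|]} := 'X_[U_(enum_rank x) + U_(enum_rank y)].
  have If : nonedge_ideal f.
    exists (fun e => if e == (x, y) then 1 else 0).
    rewrite (bigD1 (x, y)) /= ?nxy // eqxx mul1r -mpolyXD big1 ?addr0 //.
    by move=> e /andP[_ /negPf ->]; rewrite mul0r.
  case: rF => hI _ _; have /hI[u fu] := If.
  have [a aug_a] : exists a, aug F a 0 != 0.
    apply/existsP; apply: contraT => /existsPn aug0.
    have /eqP : f = 0.
      rewrite fu mxE big1 // => a _.
      by have := aug0 a; rewrite negbK => /eqP ->; rewrite mulr0.
    by rewrite -msupp_eq0 msuppX.
  exists a; have [t ta] : exists t, t \in msupp (aug F a 0).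
    move: aug_a; rewrite -msupp_eq0; case: (msupp _) => // t l _.
    by exists t; rewrite mem_head.
  case: gF => gaug _; rewrite -(gaug _ _ ta).
  have /nonedge_idealE/(_ _ ta) : nonedge_ideal (aug F a 0).
    apply/hI; exists (delta_mx 0 a); by rewrite -rowE mxE.
  rewrite lt0n mdeg_eq0; case: eqP => // -> /nonedge_mnmP[[i [j []]]|[i]].
    by rewrite mnm0E.
  by rewrite inE.
have Pa : P (gen a) by apply/PE; exists 0%N, a.
have [Pmax maxP] := max_nat_spec Pa (fun r => Pbound r N bN).
split; first exact: leq_trans ga0 (maxP _ Pa).
  (* Degrees up to [i] satisfy the bound trivially; above [i] the subtraction is exact and gives a
     value counted by [P]. *)
  exists F; split=> // i b; have [lt_ib|le_bi] := ltnP i (gen b); last first.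
    exact: leq_trans le_bi (leq_addr _ _).
  have := maxP (gen b - i)%N; rewrite leq_subLR; apply.
  by apply/PE; exists i, b; rewrite subnKC // ltnW.
by move=> r br; apply: Pbound br Pmax.
Qed.

Lemma reg_gt0 G : (0 < reg k G)%N.
Proof.
by case: (boolP (is_complete G)) => [cG|/regP[]//]; rewrite /reg cG.
Qed.

Lemma bounded_graph_reg G : bounded_graph G (reg k G).
Proof.
case: (boolP (is_complete G)) => [cG|/regP[]//]; apply/bounded_graphE.
(* For a complete graph the ideal is zero, which is bounded by any number, in particular by the
   conventional 1. *)
apply: bounded_eq_mideal (@bounded_pred0 k _ _) => t.
apply/esym/negbTE/negP => /nonedge_mnmP[[i [j [_ _]]]|[i]]; last by rewrite inE.
move/forallP/(_ (enum_val i))/forallP/(_ (enum_val j)): cG.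
by rewrite (inj_eq enum_val_inj) /nonedge => /implyP h /andP[/h ->].
Qed.

Lemma reg_leq G r : (0 < r)%N -> bounded_graph G r -> (reg k G <= r)%N.
Proof.
case: (boolP (is_complete G)) => [cG|/regP[_ _ h] _ /h //].
by rewrite /reg cG.
Qed.

End GraphIdeals.

Local Close Scope ring_scope.

Theorem theorem1p3 (k : fieldType) (char0 : [pchar k]%R =i pred0)
    (G : sgraph) (v : G) :
  reg k G <= maxn (reg k (del_vertex v)) (reg k (open_nbhd v) + 1).
Proof.
set r := maxn _ _; have r0 : (1 < r)%N.
  by rewrite leq_max addn1 ltnS reg_gt0 orbT.
apply: (reg_leq (ltnW r0)); apply/bounded_graphE.
(* [v] is added last: [W] carries [G \ v], and the vertices of [W] that are not nonadjacent to [v]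
   carry its neighbourhood. *)
pose W := [set~ enum_rank v].
rewrite -(_ : enum_rank v |: W = setT); last by rewrite setUCr.
apply: (@bounded_add_vertex _ _ _ (@nonedge_sym G) (@nonedge_irr G) W _ r
  (reg k (open_nbhd v))).
- by rewrite !inE eqxx.
- by rewrite reg_gt0 leq_max addn1 leqnn orbT.
- apply: (bounded_leq (leq_maxl _ _)).
  apply: (@bounded_induced k G [set~ v] _ _ _ (bounded_graph_reg k (del_vertex v))) => x.
  by rewrite !inE (inj_eq enum_rank_inj).
apply: (@bounded_induced k G [set w | edge v w] _ _ _ (bounded_graph_reg k (open_nbhd v))) => x.
rewrite !inE /nonedge !enum_rankK !(inj_eq enum_rank_inj) [v == x]eq_sym.
(* [v] itself is in neither set; for any other vertex, not being a nonneighbour means being a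
   neighbour. *)
by case: (eqVneq x v) => [->|_]; rewrite ?edge_irr ?negbK.
Qed.
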